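(* Let $k\ge1$ and $n-k\ge 2$. Then $$\sum_{\mathcal N\in P_{n,k}} t^{c(\mathcal N)}=\sum_{c=0}^{k}\binom{n}{c}t^c(1+t)^c.$$
   Context: Matroids on $[n]$ are given by their bases. Positroids are matroids of points of totally nonnegative Grassmannians; $Q_{n,k}$ is the set of rank $k$ positroids on $[n]$; $\mathrm{env}(\mathcal M)$ is the smallest positroid containing $\mathcal M$. For a rank $k$ matroid $\mathcal M$ let $\mathcal M^*=\{[n]\setminus J:J\in\mathcal M\}$ and $\mathcal M^{\downarrow2}=\{I\in\binom{[n]}{2}:I\subset J\text{ for some }J\in\mathcal M^*\}$. $P_{n,k}=\{\mathrm{env}(\mathcal M^{\downarrow2}):\mathcal M\in Q_{n,k}\}\subset Q_{n,2}$. Each rank 2 positroid is written $\mathcal N=(L,\{[a_1,b_1],\dots,[a_r,b_r]\})$ where $L$ is its set of loops and the $[a_i,b_i]$ are pairwise disjoint cyclic intervals of rank $1$ (all non-loops in each are parallel), with $r$ minimal and intervals as small as possible. With $S=\bigcup_i[a_i,b_i]$, $d(\mathcal N)=2k+r-|S\setminus L|-2|L|$ and $c(\mathcal N)=2k-d(\mathcal N)=2|L|+|S\setminus L|-r$. *)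

(* Defs.v *)
From HB Require Import structures.
From mathcomp Require Import all_boot all_order all_algebra.
From mathcomp Require Import boolp reals.

Set Implicit Arguments.
Unset Strict Implicit.
Unset Printing Implicit Defensive.

Import Order.TTheory GRing.Theory Num.Theory.
Local Open Scope ring_scope.

(* The ground set [n] is 'I_n with its usual order, and a matroid on [n] is
   represented by its set of bases, of type {set {set 'I_n}}. *)

Definition increasing (k n : nat) (f : {ffun 'I_k -> 'I_n}) : bool :=
  [forall i : 'I_k, forall j : 'I_k, (i < j)%N ==> (f i < f j)%N].

(* The maximal minor of A on the columns J is \det (colsub f A), where f is
   the increasing map from 'I_k to 'I_n with image J. *)
Definition row_matroid (R : realType) (k n : nat) (A : 'M[R]_(k, n)) :
    {set {set 'I_n}} :=
  [set J : {set 'I_n} | [exists f : {ffun 'I_k -> 'I_n},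
    [&& increasing f, J == f @: [set: 'I_k] & \det (colsub f A) != 0]]].

(* A represents a point (its row space) of the totally nonnegative
   Grassmannian of k-planes in R^n. *)
Definition tnn_point (R : realType) (k n : nat) (A : 'M[R]_(k, n)) : Prop :=
  \rank A = k /\
  forall f : {ffun 'I_k -> 'I_n}, increasing f -> 0 <= \det (colsub f A).

(* Q_{n,k} *)
Definition positroids (R : realType) (n k : nat) : {set {set {set 'I_n}}} :=
  [set M | `[< exists2 A : 'M[R]_(k, n), tnn_point A & M = row_matroid A >]].

Definition is_env (R : realType) (n k : nat) (M N : {set {set 'I_n}}) : bool :=
  [&& N \in positroids R n k, M \subset N &
      [forall N' in positroids R n k, (M \subset N') ==> (N \subset N')]].

(* The value set0, which is not a positroid, is taken only if there is no
   smallest positroid of rank k containing M. *)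
Definition env (R : realType) (n k : nat) (M : {set {set 'I_n}}) :
    {set {set 'I_n}} :=
  odflt set0 [pick N | is_env R k M N].

Definition dual (n : nat) (M : {set {set 'I_n}}) : {set {set 'I_n}} :=
  [set ~: J | J in M].

Definition down2 (n : nat) (M : {set {set 'I_n}}) : {set {set 'I_n}} :=
  [set I : {set 'I_n} | (#|I| == 2%N) && [exists J in dual M, I \subset J]].

(* P_{n,k} *)
Definition env_down2 (R : realType) (n k : nat) : {set {set {set 'I_n}}} :=
  [set env R 2 (down2 M) | M in positroids R n k].

Definition mrank (n : nat) (N : {set {set 'I_n}}) (X : {set 'I_n}) : nat :=
  \max_(B in N) #|B :&: X|.

Definition loops (n : nat) (N : {set {set 'I_n}}) : {set 'I_n} :=
  [set i | mrank N [set i] == 0%N].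

Definition cyc_interval (n : nat) (a b : 'I_n) : {set 'I_n} :=
  [set i : 'I_n | if (a <= b)%N then (a <= i <= b)%N
                  else (a <= i)%N || (i <= b)%N].

(* N = (L, F): L is the set of loops of N, the members of F are pairwise
   disjoint cyclic intervals of rank 1, and every dependent pair of non-loops
   lies in a member of F. *)
Definition presents (n : nat) (N F : {set {set 'I_n}}) : bool :=
  [&& [forall I in F, exists a, exists b, I == cyc_interval a b],
      trivIset F,
      [forall I in F, mrank N I == 1%N] &
      N == [set B : {set 'I_n} | [&& #|B| == 2%N, [disjoint B & loops N] &
                                    [forall I in F, ~~ (B \subset I)]]]].

(* First the number of intervals, then their total size, is minimal. *)
Definition min_presents (n : nat) (N F : {set {set 'I_n}}) : bool :=
  [&& presents N F,
      [forall F', presents N F' ==> (#|F| <= #|F'|)%N] &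
      [forall F', (presents N F' && (#|F'| == #|F|)) ==>
                  (#|cover F| <= #|cover F'|)%N]].

Definition intervals (n : nat) (N : {set {set 'I_n}}) : {set {set 'I_n}} :=
  odflt set0 [pick F | min_presents N F].

(* The subtraction does not truncate: the intervals are disjoint and each
   contains a non-loop. *)
Definition cstat (n : nat) (N : {set {set 'I_n}}) : nat :=
  (2 * #|loops N| + #|cover (intervals N) :\: loops N| - #|intervals N|)%N.

(* Main.v *)
(** Passing to the dual of a positroid of rank k turns [down2] into the
    truncation to rank 2.  A rank 2 positroid is given by its set L of loops
    and by the set S of nonloops at which a parallel class starts in the cyclic
    order, and both can be read off from the bases.  The envelopes that occur
    are exactly those with |S| >= n - k: the complement of a basis of M meets
    each parallel class at most once, and conversely Vandermonde columns, with
    equal nodes within a class and zero columns at L, give a positroid of rank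
    n - k whose dual M has [down2 M] equal to the prescribed rank 2 positroid.
    With A the complement of S, the statistic is |A| + |L| where L is any
    subset of A and |A| <= k, and the formula follows by summing over L. *)

Require Import Defs.
From HB Require Import structures.
From mathcomp Require Import all_boot all_order all_fingroup all_algebra.
From mathcomp Require Import boolp reals.
From mathcomp Require Import ring zify.

Set Implicit Arguments.
Unset Strict Implicit.
Unset Printing Implicit Defensive.

Import Order.TTheory GRing.Theory Num.Theory.
Local Open Scope ring_scope.

(** * Cyclic arcs cut out by a set of starting points *)

Section Arcs.
Open Scope nat_scope.
Variables (n : nat) (S : {set 'I_n}).
Implicit Types (i j x s : 'I_n).

Definition nbelow x := #|[set s in S | s <= x]|.

(* The elements of S cut the cycle into arcs, each containing the element of
   S at which it starts; the arc that wraps around gets the index #|S|. *)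
Definition arc_index x := if nbelow x == 0 then #|S| else nbelow x.

(* Empty, not the whole cycle, when i = j. *)
Definition oc_interval i j : {set 'I_n} :=
  [set x : 'I_n | if i <= j then i < x <= j else (i < x) || (x <= j)].

Lemma nbelow_leq i j : i <= j -> nbelow i <= nbelow j.
Proof.
move=> ij; apply/subset_leq_card/subsetP => s; rewrite !inE.
by case/andP=> -> /leq_trans->.
Qed.

Lemma nbelow_card x : nbelow x <= #|S|.
Proof. by apply/subset_leq_card/subsetP => s; rewrite inE => /andP[]. Qed.

Lemma nbelow_ltP i j : i <= j ->
  reflect (exists2 s, s \in S & i < s <= j) (nbelow i < nbelow j).
Proof.
move=> ij; apply: (iffP idP) => [|[s sS /andP[is_ sj]]].
  rewrite ltnNge => nij; suff /exists_inP[s sS sij] : [exists s in S, i < s <= j].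
    by exists s.
  apply: contraR nij => /exists_inPn H; apply/subset_leq_card/subsetP => s.
  rewrite !inE => /andP[sS sj]; rewrite sS /=.
  by have := H s sS; rewrite sj andbT -leqNgt.
apply/proper_card/properP; split.
  apply/subsetP => t; rewrite !inE => /andP[-> ti]; exact: leq_trans ij.
by exists s; rewrite !inE sS //= -ltnNge.
Qed.

Lemma nbelow_gt0P x : reflect (exists2 s, s \in S & s <= x) (0 < nbelow x).
Proof.
apply: (iffP idP) => [/card_gt0P[s]|[s sS sx]].
  by rewrite inE => /andP[]; exists s.
by apply/card_gt0P; exists s; rewrite inE sS.
Qed.

Lemma nbelow_lt_cardP x :
  reflect (exists2 s, s \in S & x < s) (nbelow x < #|S|).
Proof.
apply: (iffP idP) => [|[s sS xs]].
  rewrite ltnNge => nx; suff /exists_inP[s sS xs] : [exists s in S, x < s].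
    by exists s.
  apply: contraR nx => /exists_inPn H; apply/subset_leq_card/subsetP => s sS.
  by rewrite inE sS leqNgt H.
apply/proper_card/properP; split.
  by apply/subsetP => t; rewrite inE => /andP[].
by exists s; rewrite // inE sS /= -ltnNge.
Qed.

(** For [i < j] the indices differ iff [nbelow] grows from [i] to [j], except when it grows from 0
    to [#|S|]: then both points lie on the wrapping arc. *)
Let arc_index_ltP i j : i < j ->
  reflect ((exists2 s, s \in S & s \in oc_interval i j) /\
           (exists2 s, s \in S & s \in oc_interval j i))
    (arc_index i != arc_index j).
Proof.
move=> ij; have ij' := ltnW ij.
have h1 := nbelow_leq ij'; have h2 := nbelow_card j.
have -> : (arc_index i != arc_index j) =
    (nbelow i < nbelow j) && ((0 < nbelow i) || (nbelow j < #|S|)).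
  rewrite /arc_index; case: (nbelow i =P 0); case: (nbelow j =P 0); lia.
apply: (iffP andP) => -[].
  move=> /(nbelow_ltP ij')[s sS sij] H; split.
    by exists s; rewrite // inE ij'.
  case/orP: H => [/nbelow_gt0P|/nbelow_lt_cardP] [t tS tH]; exists t => //;
    by rewrite inE [j <= i]leqNgt ij tH ?orbT.
move=> [s sS]; rewrite inE ij' => sij [t tS]; rewrite inE leqNgt ij /= => tH.
split; first by apply/(nbelow_ltP ij'); exists s.
case/orP: tH => tH; apply/orP; [right|left].
  by apply/nbelow_lt_cardP; exists t.
by apply/nbelow_gt0P; exists t.
Qed.

Lemma arc_index_neqP i j :
  reflect ((exists2 s, s \in S & s \in oc_interval i j) /\
           (exists2 s, s \in S & s \in oc_interval j i))
    (arc_index i != arc_index j).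
Proof.
case: (ltngtP i j) => [ij|ji|/val_inj ->].
- exact: arc_index_ltP.
- rewrite eq_sym; apply: (iffP (arc_index_ltP ji)) => -[]; by split.
- rewrite eqxx; constructor => -[[s _]]; rewrite inE leqnn; lia.
Qed.

Lemma arc_index_inj : {in S &, injective arc_index}.
Proof.
move=> s t sS tS /eqP; apply: contraTeq => st; apply/arc_index_neqP; split.
  exists t => //; rewrite inE leqnn; case: ltngtP => // /val_inj E.
  by rewrite E eqxx in st.
exists s => //; rewrite inE leqnn; case: ltngtP => // /val_inj E.
by rewrite E eqxx in st.
Qed.

(** The start is the largest element of [S] that is at most [x]. If there is none, [x] lies on the
    wrapping arc, which starts at the largest element of [S]. *)
Lemma arc_start x : 0 < #|S| -> exists2 s, s \in S & arc_index s = arc_index x.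
Proof.
move=> /card_gt0P[s0 s0S].
have [/nbelow_gt0P[s1 s1S s1x]|] := boolP (0 < nbelow x).
  have H : (s1 \in S) && (s1 <= x) by rewrite s1S.
  case: (@arg_maxnP _ s1 (fun s => (s \in S) && (s <= x)) (@nat_of_ord n) H).
  move=> s /andP[sS sx] smax; exists s => //; apply/eqP.
  apply: contraT => /arc_index_neqP[[t tS]]; rewrite inE sx => /andP[st tx].
  by have := smax t; rewrite tS tx /= leqNgt st => /(_ isT).
rewrite -eqn0Ngt => /eqP nx0.
case: (@arg_maxnP _ s0 (fun s => s \in S) (@nat_of_ord n) s0S) => s sS smax.
exists s => //; apply/eqP; apply: contraT => /arc_index_neqP[[t tS]].
have xs : x < s.
  rewrite ltnNge; apply/negP => sx.
  by have := @nbelow_gt0P x; rewrite nx0 => /elimF-/(_ erefl); apply; exists s.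
rewrite inE leqNgt xs /= => /orP[st|tx].
  by have := smax t tS; rewrite /= leqNgt st.
by have := @nbelow_gt0P x; rewrite nx0 => /elimF-/(_ erefl) []; exists t.
Qed.

Lemma arc_index_gt0 x : 0 < #|S| -> 0 < arc_index x.
Proof. by rewrite /arc_index; case: eqP => //; lia. Qed.

Lemma arc_index_card x : arc_index x <= #|S|.
Proof. by rewrite /arc_index; case: eqP => // _; apply: nbelow_card. Qed.

(* Both kinds of fibre, plain and wrapping, are covered: with a the start of
   the arc, b is its largest element, or, if the arc wraps around, the largest
   element before the first element of S. *)
Lemma arc_cyc_interval x : 0 < #|S| ->
  exists a b, [set y | arc_index y == arc_index x] = cyc_interval a b.
Proof.
move=> S0; have [a aS ax] := arc_start x S0; exists a.
have na0 : 0 < nbelow a by apply/nbelow_gt0P; exists a.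
have vaE : arc_index a = nbelow a by rewrite /arc_index eqn0Ngt na0.
have alt (y : 'I_n) : y < a -> nbelow y < nbelow a.
  by move=> ya; apply/(nbelow_ltP (ltnW ya)); exists a; rewrite // leqnn ya.
have [/existsP[y0 Hy0]|/existsPn H0] :=
  boolP [exists y, (nbelow y == 0) && (nbelow a == #|S|)].
  case/andP: (Hy0) => ny0 naS.
  case: (@arg_maxnP _ y0 (fun y => nbelow y == 0) (@nat_of_ord n) ny0) => b nb0 bmax.
  exists b; apply/setP => y; rewrite !inE -ax.
  have ba : b < a.
    by rewrite ltnNge; apply/negP => /nbelow_leq; rewrite (eqP nb0) leqNgt na0.
  rewrite leqNgt ba /= vaE; apply/idP/idP.
    rewrite /arc_index; case: (nbelow y =P 0) => [/eqP ny _|_ /eqP ny].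
      by have /= -> := bmax y ny; rewrite orbT.
    by rewrite leqNgt; case: ltnP => // /alt; rewrite ny ltnn.
  case/orP => [/nbelow_leq|/nbelow_leq] H; rewrite /arc_index.
    have := nbelow_card y; case: (nbelow y =P 0); lia.
  by move: H; rewrite (eqP nb0) leqn0 => ->; rewrite eq_sym.
case: (@arg_maxnP _ a (fun y => nbelow y == nbelow a) (@nat_of_ord n) (eqxx _)).
move=> b /eqP nb bmax; exists b; apply/setP => y; rewrite !inE -ax vaE.
have /= -> := bmax a (eqxx _); apply/idP/idP.
  rewrite /arc_index; case: (nbelow y =P 0) => [ny /eqP H|_ /eqP ny].
    by have := H0 y; rewrite ny eqxx H eqxx.
  have /= -> := bmax y (introT eqP ny); rewrite andbT leqNgt.
  by apply/negP => /alt; rewrite ny ltnn.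
case/andP=> /nbelow_leq H1 /nbelow_leq H2; rewrite /arc_index.
by case: (nbelow y =P 0); lia.
Qed.

End Arcs.

(** * Minors and the exchange property *)

Section Minors.
Variables (k n : nat).
Implicit Types (f g : {ffun 'I_k -> 'I_n}) (J : {set 'I_n}).

Lemma increasingP f :
  reflect (forall i j : 'I_k, (i < j)%N -> (f i < f j)%N) (increasing f).
Proof.
apply: (iffP forallP) => [H i j ij|H i].
  by have /forallP/(_ j)/implyP := H i; apply.
by apply/forallP => j; apply/implyP; apply: H.
Qed.

Lemma increasing_inj f : increasing f -> injective f.
Proof.
move=> /increasingP fI i j; case: (ltngtP i j) => [/fI|/fI|/val_inj//] H E;
  by rewrite E ltnn in H.
Qed.

Lemma increasing_enum J : #|J| = k ->
  exists2 f : {ffun 'I_k -> 'I_n}, increasing f & f @: [set: 'I_k] = J.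
Proof.
move=> cJ; pose e i := Order.enum_val (cast_ord (esym cJ) i).
have eI : increasing (finfun e).
  apply/increasingP => i j; rewrite !ffunE; apply: contraTT; rewrite -!leqNgt.
  have := Order.EnumVal.le_enum_val (@le_total _ 'I_n)
     (cast_ord (esym cJ) j) (cast_ord (esym cJ) i).
  by rewrite /= !leEord => ->.
exists (finfun e) => //; apply/eqP; rewrite eqEcard; apply/andP; split.
  apply/subsetP => _ /imsetP[i _ ->]; rewrite ffunE; exact: Order.EnumVal.enum_valP.
by rewrite card_imset ?cardsT ?card_ord ?cJ //; apply: increasing_inj.
Qed.

Variable R : realType.
Implicit Type A : 'M[R]_(k, n).

(** Column spans are written with [A^T] because matrices represent subspaces by their row spaces. *)
Definition colspan A J := (\sum_(i in J) <<row i A^T>>)%MS.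

Lemma row_colspan A J i : i \in J -> (row i A^T <= colspan A J)%MS.
Proof. by move=> iJ; apply: (sumsmx_sup i); rewrite ?genmxE. Qed.

Lemma colspan_subP A J p (B : 'M[R]_(p, k)) :
  reflect (forall i, i \in J -> (row i A^T <= B)%MS) (colspan A J <= B)%MS.
Proof.
apply: (iffP sumsmx_subP) => H i /H; by rewrite genmxE.
Qed.

Lemma minor_neq0 A f : (\det (colsub f A) != 0) =
  (\rank (colspan A (f @: [set: 'I_k])) == k).
Proof.
rewrite -unitfE -[_ \is a _]/(colsub f A \in unitmx) -unitmx_tr -row_full_unit.
rewrite trmx_mxsub; congr (_ == _).
apply/eqP; rewrite eqn_leq; apply/andP; split; apply: mxrankS.
  apply/row_subP => i; rewrite row_rowsub row_colspan //.
  by apply/imsetP; exists i.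
apply/colspan_subP => _ /imsetP[i _ ->].
by rewrite -row_rowsub row_sub.
Qed.

Lemma row_matroidE A J :
  (J \in row_matroid A) = (#|J| == k) && (\rank (colspan A J) == k).
Proof.
rewrite inE; apply/existsP/andP => [[f /and3P[fI /eqP-> fn0]]|[/eqP cJ rJ]].
  rewrite card_imset; last exact: increasing_inj.
  by rewrite cardsT card_ord eqxx -minor_neq0.
have [f fI fJ] := increasing_enum cJ; exists f.
by rewrite fI -fJ eqxx minor_neq0 fJ rJ.
Qed.

Lemma mem_row_matroid A f : increasing f ->
  (f @: [set: 'I_k] \in row_matroid A) = (\det (colsub f A) != 0).
Proof.
move=> fI; rewrite row_matroidE minor_neq0 card_imset; last exact: increasing_inj.
by rewrite cardsT card_ord eqxx.
Qed.

Lemma row_matroid_card A J : J \in row_matroid A -> #|J| = k.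
Proof. by rewrite row_matroidE => /andP[/eqP]. Qed.

(** The columns in [J :\ j] span a hyperplane [U], while those in [J'] span the whole space, so some
    column [x] of [J'] lies outside [U] and completes [J :\ j] to a basis. *)
Lemma row_matroid_exchange A J J' j :
    J \in row_matroid A -> J' \in row_matroid A -> j \in J -> j \notin J' ->
  exists2 x, (x \in J') && (x \notin J) & x |: (J :\ j) \in row_matroid A.
Proof.
rewrite !row_matroidE => /andP[/eqP cJ /eqP rJ] /andP[/eqP cJ' /eqP rJ'] jJ jJ'.
set U := colspan A (J :\ j).
have k0 : (0 < k)%N by rewrite -cJ; apply/card_gt0P; exists j.
have cU : #|J :\ j| = k.-1 by rewrite -cJ [in RHS](cardsD1 j) jJ.
have rU1 : (\rank U <= k.-1)%N.
  rewrite -cU -sum1_card /U /colspan.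
  apply: (big_rec2 (fun (B : 'M_k) r => \rank B <= r)%N); first by rewrite mxrank0.
  move=> i r B _ rB; apply: leq_trans (mxrank_adds_leqif _ _) _.
  by rewrite leq_add // mxrank_gen rank_leq_row.
have rU2 : (k.-1 <= \rank U)%N.
  have : (\rank (row j A^T + U)%MS = k).
    apply/eqP; rewrite eqn_leq rank_leq_col -[leqLHS]rJ mxrankS //.
    apply/colspan_subP => i iJ; have [->|ij] := eqVneq i j.
      exact: addsmxSl.
    apply: submx_trans (addsmxSr _ _); apply: row_colspan.
    by rewrite !inE ij.
  have := (mxrank_adds_leqif (row j A^T) U).1; have := rank_leq_row (row j A^T).
  lia.
have /existsP[x /andP[xJ' xU]] : [exists x, (x \in J') && ~~ (row x A^T <= U)%MS].
  apply: contraT => /existsPn H.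
  have : (colspan A J' <= U)%MS.
    by apply/colspan_subP => i iJ'; have := H i; rewrite iJ' negbK.
  move=> /mxrankS; rewrite rJ'; lia.
have xJ : x \notin J :\ j by apply: contra xU; apply: row_colspan.
have xj : x != j by apply: contraNneq jJ' => <-.
exists x; first by rewrite xJ' /=; apply: contra xJ; rewrite !inE xj.
rewrite row_matroidE cardsU1 xJ cU add1n prednK // eqxx /=.
have UV : (U <= colspan A (x |: J :\ j))%MS.
  by apply/colspan_subP => i iJ; apply: row_colspan; rewrite inE iJ orbT.
rewrite eqn_leq rank_leq_col /=.
have : (\rank U < \rank (colspan A (x |: J :\ j)))%N.
  rewrite (ltn_leqif (mxrank_leqif_sup UV)).
  apply: contra xU => H; apply: submx_trans H; apply: row_colspan.
  by rewrite inE set11.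
lia.
Qed.

Lemma row_matroid_neq0 A : \rank A = k -> exists J, J \in row_matroid A.
Proof.
move=> rA; have full : row_full A^T by rewrite -col_leq_rank mxrank_tr rA.
pose f := fullrankfun full; exists (f @: [set: 'I_k]); rewrite row_matroidE.
rewrite card_imset ?cardsT ?card_ord ?eqxx /=; last exact: fullrankfun_inj.
rewrite eqn_leq rank_leq_col /= -[leqLHS](mxrank_fullrowsub full).
apply/mxrankS/row_subP => i.
by rewrite row_rowsub row_colspan ?imset_f.
Qed.

Lemma minor_rank A f : \det (colsub f A) != 0 -> \rank A = k.
Proof.
rewrite minor_neq0 => /eqP r; apply/eqP; rewrite eqn_leq rank_leq_row /=.
rewrite -[leqLHS]r -(mxrank_tr A); apply/mxrankS/colspan_subP => i _; exact: row_sub.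
Qed.

End Minors.

(** * Duality of total nonnegativity *)

Lemma sum_ltn_ord n c : (c <= n)%N -> (\sum_(x < n) (x < c) = c)%N.
Proof.
move=> cn; rewrite -[RHS]card_ord -sum1_card (big_ord_widen _ (fun=> 1%N) cn).
by rewrite [RHS]big_mkcond; apply: eq_bigr => i _; case: ltnP.
Qed.

Section ComplementaryMinors.
Variables (R : realType) (m k : nat).

(* Apply s to the nodes of a Vandermonde determinant with increasing nodes:
   its sign is the sign of s, and only pairs made of one index of each block
   can contribute a negative factor. *)
Lemma shuffle_sign (s : 'S_(m + k)) :
    {homo (fun i => s (lshift k i)) : i j / (i < j)%N} ->
    {homo (fun j => s (rshift m j)) : i j / (i < j)%N} ->
  (-1) ^+ s = \prod_(j < k) (-1) ^+ (m + j + s (rshift m j)) :> R.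
Proof.
move=> fI gI; pose f i := s (lshift k i); pose g j := s (rshift m j).
pose a : 'rV[R]_(m + k) := \row_x (x%:R).
have sgB (x y : 'I_(m + k)) : x != y ->
    Num.sg (x%:R - y%:R : R) = (-1) ^+ (x < y)%N.
  move=> xy; case: ltngtP => [H|H|/val_inj E]; last by rewrite E eqxx in xy.
    by rewrite ltr0_sg // subr_lt0 ltr_nat.
  by rewrite gtr0_sg // subr_gt0 ltr_nat.
have d1 : Num.sg (\det (Vandermonde (m + k) a)) = 1.
  apply: gtr0_sg; rewrite det_Vandermonde; apply: prodr_gt0 => i _.
  by apply: prodr_gt0 => j ij; rewrite !mxE subr_gt0 ltr_nat.
have d2 : \det (Vandermonde (m + k) (\row_x (s x)%:R)) =
    \det (Vandermonde (m + k) a) * (-1) ^+ s.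
  rewrite -(odd_permV s) -det_perm -det_mulmx -col_permE; congr (\det _).
  by apply/matrixP => i j; rewrite !mxE.
have -> : (-1) ^+ s =
    Num.sg (\det (Vandermonde (m + k) (\row_x (s x)%:R : 'rV[R]_(m + k)))).
  by rewrite d2 sgrM d1 mul1r sgrX sgrN1.
(* Of the [g j] values below [g j], [j] are values of [g] and the others are values of [f]. Hence
   [m + j - g j] of the [f i] exceed [g j]; this number of inversions has the parity of
   [m + j + g j]. *)
have NE (j : 'I_k) : ((\sum_(i < m) (g j < f i)) + g j = m + j)%N.
  have H := sum_ltn_ord (ltnW (ltn_ord (g j))).
  rewrite -[X in (_ + X)%N = _]H (reindex_inj (@perm_inj _ s)) big_split_ord /= addnA.
  congr (_ + _)%N.
    rewrite -big_split -[RHS]card_ord -sum1_card; apply: eq_bigr => i _ /=.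
    have : f i != g j by rewrite (inj_eq perm_inj) eq_lrshift.
    by rewrite /f /g; case: ltngtP => // /val_inj -> /eqP.
  rewrite -[RHS](sum_ltn_ord (ltnW (ltn_ord j))).
  apply: eq_bigr => i _; rewrite -[s (rshift m i)]/(g i).
  case: (ltngtP i j) => [/gI -> //|/gI|/val_inj ->]; last by rewrite ltnn.
  by rewrite -/(g i) -/(g j); case: ltngtP.
rewrite det_Vandermonde big_split_ord /= sgrM -[RHS]mul1r [LHS]mulrC; congr (_ * _).
  rewrite (big_morph _ (@sgrM R) (sgr1 R)); apply: big1 => j _.
  rewrite (big_morph _ (@sgrM R) (sgr1 R)); apply: big1 => x.
  case: (split_ordP x) => i -> /= ij; first by have := ltn_ord i; lia.
  by rewrite !mxE; apply: gtr0_sg; rewrite subr_gt0 ltr_nat gI //; lia.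
rewrite (big_morph _ (@sgrM R) (sgr1 R)).
under eq_bigr => i _.
  rewrite (big_morph _ (@sgrM R) (sgr1 R)) big_split_ord /= big1 ?mul1r; last first.
    by move=> j ij; rewrite !mxE; apply: gtr0_sg; rewrite subr_gt0 ltr_nat fI.
  rewrite big_mkcond /=.
  under eq_bigr => j _.
    rewrite ltn_addr // !mxE sgB ?(inj_eq perm_inj) ?eq_rlshift //.
  over.
over.
rewrite exchange_big /=; apply: eq_bigr => j _.
rewrite -NE addnAC -addnA -signr_odd oddD addnn odd_double addbF signr_odd.
by rewrite expr_sum.
Qed.

(* Jacobi's complementary minor theorem, the columns of Y being a basis of the
   kernel of B. *)
Lemma complementary_minors (B : 'M[R]_(m, m + k)) : \rank B = m ->
  exists (Y : 'M[R]_(m + k, k)) (d : R), d != 0 /\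
    forall s : 'S_(m + k),
      d * (-1) ^+ s * \det (rowsub (fun j => s (rshift m j)) Y) =
      \det (colsub (fun i => s (lshift k i)) B).
Proof.
(* By Gaussian elimination [W] completes [B] to an invertible matrix, and [Y] consists of the last
   [k] columns of the inverse of [W]. *)
move=> rB; pose U := row_ebase B; pose L := col_ebase B.
pose W := block_mx L 0 0 1%:M *m U.
pose Y : 'M_(m + k, k) := invmx U *m col_mx 0 1%:M.
have uU : U \in unitmx by apply: row_ebase_unit.
have WB : usubmx W = B.
  have := mulmx_ebase B; rewrite -/U -/L rB pid_mx_row mul_mx_row mulmx1 mulmx0.
  by rewrite /W /block_mx mul_col_mx col_mxKu.
have WY : W *m Y = col_mx 0 1%:M.
  by rewrite /W /Y -mulmxA mulKVmx // mul_block_col !mul0mx !mulmx0 mulmx1 !add0r.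
exists Y, (\det W); split.
  rewrite det_mulmx det_lblock det1 mulr1 mulf_neq0 // -unitfE.
    exact: col_ebase_unit.
  exact: row_ebase_unit.
move=> s; have -> : \det W * (-1) ^+ s = \det (col_perm s W).
  by rewrite col_permE [RHS]det_mulmx det_perm odd_permV.
(* The product of [col_perm s W] and [X] is block lower triangular, its diagonal blocks being the
   chosen columns of [B] and the identity, while [\det X] is the complementary minor of [Y]. *)
pose X := row_mx (col_mx 1%:M 0) (row_perm s Y) : 'M_(m + k).
have -> : \det (rowsub (fun j => s (rshift m j)) Y) = \det X.
  rewrite /X -[row_perm s Y]vsubmxK -block_mxEh det_ublock det1 mul1r.
  by congr (\det _); apply/matrixP => i j; rewrite !mxE.
rewrite -det_mulmx mul_mx_row.
have -> : col_perm s W *m row_perm s Y = col_mx 0 1%:M.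
  by rewrite mul_col_perm -row_permM mulVg row_perm1.
rewrite -[col_perm s W]hsubmxK mul_row_col mulmx1 mulmx0 addr0.
rewrite -[lsubmx _]vsubmxK -block_mxEh det_lblock det1 mulr1.
congr (\det _); rewrite -[in RHS]WB; apply/matrixP => i j; by rewrite !mxE.
Qed.

Lemma det_scale_rows_cols p (a b : 'I_p -> R) (M : 'M[R]_p) :
  \det (\matrix_(i, j) (a i * M i j * b j)) =
  \prod_i a i * \det M * \prod_j b j.
Proof.
have -> : \matrix_(i, j) (a i * M i j * b j) =
    diag_mx (\row_i a i) *m M *m diag_mx (\row_j b j).
  by apply/matrixP => i j; rewrite mul_mx_diag mul_diag_mx !mxE.
rewrite !det_mulmx !det_diag; congr (_ * _ * _); apply: eq_bigr => i _;
  by rewrite mxE.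
Qed.

Lemma shuffle_perm (f : {ffun 'I_m -> 'I_(m + k)}) (g : {ffun 'I_k -> 'I_(m + k)}) :
    injective f -> injective g -> g @: [set: 'I_k] = ~: (f @: [set: 'I_m]) ->
  exists s : 'S_(m + k),
    (forall i, s (lshift k i) = f i) /\ (forall j, s (rshift m j) = g j).
Proof.
move=> fI gI gf.
have fg i j : f i != g j.
  have : g j \in g @: [set: 'I_k] by apply: imset_f.
  by rewrite gf inE; apply: contraNneq => <-; apply: imset_f.
pose h x := match split x with inl i => f i | inr j => g j end.
have hl i : h (lshift k i) = f i by rewrite /h (unsplitK (inl i)).
have hr j : h (rshift m j) = g j by rewrite /h (unsplitK (inr j)).
have hI : injective h.
  move=> x y; case: (split_ordP x) => i ->; case: (split_ordP y) => j ->;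
    rewrite ?hl ?hr.
  - by move/fI->.
  - by move=> /eqP; rewrite (negPf (fg _ _)).
  - by move=> /esym /eqP; rewrite (negPf (fg _ _)).
  - by move/gI->.
by exists (perm hI); split=> i; rewrite permE.
Qed.

(** By [shuffle_sign] the sign in [complementary_minors] is a constant times one factor for each
    column of the minor. Alternating signs on the columns of [Y^T] and a constant on one row absorb
    it. *)
Lemma tnn_complement (B : 'M[R]_(m, m + k)) : (0 < k)%N -> \rank B = m ->
  exists A : 'M[R]_(k, m + k),
    forall (f : {ffun 'I_m -> 'I_(m + k)}) (g : {ffun 'I_k -> 'I_(m + k)}),
      increasing f -> increasing g ->
      g @: [set: 'I_k] = ~: (f @: [set: 'I_m]) ->
    \det (colsub g A) = \det (colsub f B).
Proof.
move=> k0 rB; have [Y [d [d0 dY]]] := complementary_minors rB.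
pose e : R := \prod_(j < k) (-1) ^+ (m + j).
have ee : e * e = 1.
  by rewrite -big_split big1 //= => j _; rewrite -exprMn mulrNN mulr1 expr1n.
(* Only the first row carries [e * d], so this constant enters each maximal minor exactly once. *)
pose a (i : 'I_k) := if i == Ordinal k0 then e * d else 1.
pose A : 'M[R]_(k, m + k) := \matrix_(i, x) (a i * Y x i * (-1) ^+ x).
exists A => f g fI gI gf.
have [s [sf sg]] := shuffle_perm (increasing_inj fI) (increasing_inj gI) gf.
have -> : colsub f B = colsub (fun i => s (lshift k i)) B.
  by apply/matrixP => i j; rewrite !mxE sf.
rewrite -dY; have -> : colsub g A = \matrix_(i, j) (a i *
    (rowsub (fun j => s (rshift m j)) Y)^T i j * (-1) ^+ (s (rshift m j))).
  by apply/matrixP => i j; rewrite !mxE sg.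
rewrite det_scale_rows_cols det_tr (bigD1 (Ordinal k0)) //= big1; last first.
  by move=> i /negPf i0; rewrite /a i0.
rewrite mulr1 {1}/a eqxx; set D := \det _.
have -> : (-1) ^+ s = e * \prod_(j < k) (-1) ^+ s (rshift m j) :> R.
  rewrite -big_split /= shuffle_sign; last 2 first.
  - by move=> i j ij; rewrite !sf; apply: (increasingP _ fI).
  - by move=> i j ij; rewrite !sg; apply: (increasingP _ gI).
  by apply: eq_bigr => j _; rewrite exprD.
ring.
Qed.

Lemma tnn_dual (B : 'M[R]_(m, m + k)) : (0 < k)%N -> tnn_point B ->
  exists2 A : 'M[R]_(k, m + k), tnn_point A & row_matroid A = dual (row_matroid B).
Proof.
move=> k0 [rB pB]; have [A HA] := tnn_complement k0 rB.
have cf (g : {ffun 'I_k -> 'I_(m + k)}) : increasing g ->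
    exists2 f : {ffun 'I_m -> 'I_(m + k)}, increasing f &
      f @: [set: 'I_m] = ~: (g @: [set: 'I_k]).
  move=> gI; apply: increasing_enum; rewrite cardsCs setCK card_ord.
  by rewrite card_imset ?cardsT ?card_ord ?addnK //; apply: increasing_inj.
have AB : row_matroid A = dual (row_matroid B).
  apply/setP => J; apply/idP/imsetP => [JA|[J' J'B ->]].
    have [g gI gJ] := increasing_enum (row_matroid_card JA).
    have [f fI fg] := cf g gI.
    exists (~: J); last by rewrite setCK.
    rewrite -gJ -fg mem_row_matroid // -(HA f g) ?fg ?setCK //.
    by rewrite -mem_row_matroid // gJ.
  have [f fI fJ] := increasing_enum (row_matroid_card J'B).
  have [g gI gJ] : exists2 g : {ffun 'I_k -> 'I_(m + k)}, increasing g &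
      g @: [set: 'I_k] = ~: J'.
    apply: increasing_enum; rewrite cardsCs setCK card_ord.
    by rewrite (row_matroid_card J'B) addKn.
  by rewrite -gJ mem_row_matroid // (HA f g) ?gJ ?fJ // -mem_row_matroid ?fJ.
exists A => //; split; last first.
  move=> g gI; have [f fI fg] := cf g gI.
  by rewrite (HA f g) ?fg ?setCK //; apply: pB.
have [J' J'B] := row_matroid_neq0 rB.
have : ~: J' \in row_matroid A by rewrite AB imset_f.
move=> JA; have [g gI gJ] := increasing_enum (row_matroid_card JA).
by apply: (@minor_rank _ _ _ A g); rewrite -mem_row_matroid // gJ.
Qed.

End ComplementaryMinors.

Lemma tnn_dual_cast (R : realType) (n m k : nat) (B : 'M[R]_(m, n)) :
    n = (m + k)%N -> (0 < k)%N -> tnn_point B ->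
  exists2 A : 'M[R]_(k, n), tnn_point A & row_matroid A = dual (row_matroid B).
Proof. by move=> nE; subst n; apply: tnn_dual. Qed.

(** * Positroids whose parallel classes are arcs *)

Section ArcMatroid.
Variable n : nat.
Implicit Types (L S J : {set 'I_n}).

(** The truncation to rank [m] of the partition matroid with loops [L] whose blocks are the nonloops
    of each arc. *)
Definition arc_matroid L S (m : nat) : {set {set 'I_n}} :=
  [set J : {set 'I_n} |
    [&& #|J| == m, [disjoint J & L] & dinjectiveb (arc_index S) J]].

Lemma disjoints_setU L J J' :
  [disjoint J :|: J' & L] = [disjoint J & L] && [disjoint J' & L].
Proof. by rewrite !disjoints_subset subUset. Qed.

Lemma arc_matroid_pair L S i j : ([set i; j] \in arc_matroid L S 2) =
  [&& i \notin L, j \notin L & arc_index S i != arc_index S j].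
Proof.
rewrite inE cards2 disjoints_setU !disjoints1; apply/and3P/and3P => -[].
  move=> ij /andP[iL jL] /dinjectiveP H; split=> //.
  by apply: contraTneq ij => /H->; rewrite ?inE ?eqxx ?orbT.
move=> iL jL vij; split; rewrite ?iL ?jL //.
  by case: (i =P j) vij => // ->; rewrite eqxx.
apply/dinjectiveP => x y; rewrite !inE => /orP[]/eqP-> /orP[]/eqP-> //;
  by move=> E; rewrite E eqxx in vij.
Qed.

Lemma setI_start L S x : [disjoint S & L] -> (0 < #|S|)%N ->
  exists s, [/\ s \in S, s \notin L & arc_index S s = arc_index S x].
Proof.
move=> SL S0; have [s sS sx] := arc_start x S0; exists s; split=> //.
by rewrite (disjointFr SL sS).
Qed.

Variable R : realType.

(* Up to the sign of the wrapping arc, which a cyclic rotation of the columns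
   forces, the columns lie on the moment curve at the arc indices. *)
Definition arc_mx L S m : 'M[R]_(m, n) :=
  \matrix_(r < m, x < n) ((arc_index S x)%:R ^+ r *
    ((x \notin L)%:R * (if nbelow S x == 0 then (-1) ^+ m.-1 else 1))).

Lemma det_arc_mx L S m (f : 'I_m -> 'I_n) : \det (colsub f (arc_mx L S m)) =
  \prod_(i < m) \prod_(j < m | (i < j)%N)
     ((arc_index S (f j))%:R - (arc_index S (f i))%:R) *
  \prod_(j < m) ((f j \notin L)%:R *
      (if nbelow S (f j) == 0 then (-1) ^+ m.-1 else 1)).
Proof.
have -> : colsub f (arc_mx L S m) = \matrix_(i, j)
   (1 * Vandermonde m (\row_j (arc_index S (f j))%:R : 'rV[R]_m) i j *
   ((f j \notin L)%:R * (if nbelow S (f j) == 0 then (-1) ^+ m.-1 else 1))).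
  by apply/matrixP => i j; rewrite !mxE mul1r.
rewrite det_scale_rows_cols big1 // mul1r det_Vandermonde; congr (_ * _).
by apply: eq_bigr => i _; apply: eq_bigr => j _; rewrite !mxE.
Qed.

(** The Vandermonde factor vanishes iff two columns lie on the same arc, the scaling factor iff some
    column is in [L]. *)
Lemma det_arc_mx_neq0 L S m (f : {ffun 'I_m -> 'I_n}) : increasing f ->
  (\det (colsub f (arc_mx L S m)) != 0) =
  (f @: [set: 'I_m] \in arc_matroid L S m).
Proof.
move=> fI; have fi := increasing_inj fI.
rewrite det_arc_mx inE card_imset // cardsT card_ord eqxx /= mulf_eq0 negb_or andbC.
congr (_ && _).
  apply/prodf_neq0/pred0P => [H x|H i _].
    rewrite /=; apply/negbTE; apply/negP => /andP[/imsetP[i _ ->] fL].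
    by have := H i isT; rewrite fL mul0r eqxx.
  have fJ : f i \in f @: [set: 'I_m] by apply: imset_f.
  have /= := H (f i); rewrite fJ /= => ->.
  by rewrite mul1r; case: ifP; rewrite ?signr_eq0 ?oner_eq0.
apply/prodf_neq0/dinjectiveP => [H x y /imsetP[i _ ->] /imsetP[j _ ->] E|H i _].
  congr (f _); case: (ltngtP i j) => [ij|ij|/val_inj //].
    by have /prodf_neq0/(_ j ij) := H i isT; rewrite E subrr eqxx.
  by have /prodf_neq0/(_ i ij) := H j isT; rewrite E subrr eqxx.
apply/prodf_neq0 => j ij; rewrite subr_eq0 eqr_nat.
apply: contraTneq ij => /H E.
by rewrite (fi _ _ (E (imset_f _ (in_setT _)) (imset_f _ (in_setT _)))) ltnn.
Qed.

(** In a nonzero minor only the first column can lie before all of [S], since two such columns share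
    the wrapping arc. The other nodes increase. If the first column does wrap, its node [#|S|] is
    the largest, and the [m.-1] negative differences are cancelled by its sign [(-1) ^+ m.-1]. *)
Lemma det_arc_mx_ge0 L S m (f : {ffun 'I_m -> 'I_n}) : increasing f ->
  0 <= \det (colsub f (arc_mx L S m)).
Proof.
move=> fI; have [->//|] := eqVneq (\det (colsub f (arc_mx L S m))) 0.
rewrite det_arc_mx_neq0 // inE => /and3P[_ dL /dinjectiveP vI].
have fL j : f j \notin L by rewrite (disjointFr dL) // imset_f.
have {vI}vI i j : arc_index S (f i) = arc_index S (f j) -> i = j.
  by move=> E; apply: (increasing_inj fI); apply: vI; rewrite ?imset_f.
rewrite det_arc_mx; case: m f fI fL vI {dL} => [|p] f fI fL vI.
  by rewrite !big_ord0 mulr1.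
have vh i : (0 < nbelow S (f i))%N -> arc_index S (f i) = nbelow S (f i).
  by rewrite /arc_index lt0n => /negPf->.
have hM (i j : 'I_p.+1) : (i < j)%N -> (nbelow S (f i) <= nbelow S (f j))%N.
  by move=> ij; apply: nbelow_leq; apply/ltnW/(increasingP _ fI).
have h0 (i : 'I_p) : (0 < nbelow S (f (lift ord0 i)))%N.
  rewrite lt0n; apply/negP => /eqP hi.
  have := @hM ord0 (lift ord0 i) isT; rewrite hi leqn0 => /eqP h0.
  have : arc_index S (f ord0) = arc_index S (f (lift ord0 i)).
    by rewrite /arc_index hi h0.
  by move/vI.
rewrite !big_ord_recl -mulrA mulrCA; apply: mulr_ge0.
  apply: prodr_ge0 => i _; apply: prodr_ge0 => j ij; rewrite subr_ge0 ler_nat.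
  have := hM _ _ ij; have hi := h0 i.
  by move=> hj; rewrite !vh //; apply: leq_trans hj.
rewrite [X in _ * (_ * X)]big1 => [|i _]; last first.
  by rewrite fL eqn0Ngt h0 mulr1.
rewrite mulr1 fL mul1r big_mkcond big_ord_recl /= mul1r.
have [n0|n0] := eqVneq (nbelow S (f ord0)) 0%N.
  have -> : \prod_(i < p) ((arc_index S (f (lift ord0 i)))%:R -
      (arc_index S (f ord0))%:R) = (-1) ^+ p * \prod_(i < p)
     ((arc_index S (f ord0))%:R - (arc_index S (f (lift ord0 i)))%:R) :> R.
    rewrite -[in (-1) ^+ p](card_ord p) -prodrN.
    by apply: eq_bigr => i _; rewrite opprB.
  rewrite mulrC mulrA -exprMn mulrNN mulr1 expr1n mul1r.
  apply: prodr_ge0 => i _; rewrite subr_ge0 ler_nat [in leqRHS]/arc_index n0.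
  exact: arc_index_card.
rewrite mulr1; apply: prodr_ge0 => i _; rewrite subr_ge0 ler_nat.
by rewrite (vh _ (h0 i)) vh ?lt0n // hM.
Qed.

Lemma arc_mx_row_matroid L S m : row_matroid (arc_mx L S m) = arc_matroid L S m.
Proof.
apply/setP => J; apply/idP/idP => [JA|].
  have [f fI fJ] := increasing_enum (row_matroid_card JA).
  by rewrite -fJ -det_arc_mx_neq0 // -mem_row_matroid // fJ.
move=> JA; have cJ : #|J| = m by move: JA; rewrite inE => /andP[/eqP].
have [f fI fJ] := increasing_enum cJ.
by rewrite -fJ mem_row_matroid // det_arc_mx_neq0 // fJ.
Qed.

Lemma arc_mx_tnn L S m : [disjoint S & L] -> (m <= #|S|)%N ->
  tnn_point (arc_mx L S m).
Proof.
move=> SL mS; split; last by move=> f; apply: det_arc_mx_ge0.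
have /card_gt0P[J] : (0 < #|[set J : {set 'I_n} | J \subset S & #|J| == m]|)%N.
  by rewrite cards_draws bin_gt0.
rewrite inE => /andP[JS /eqP cJ]; have [f fI fJ] := increasing_enum cJ.
apply: (@minor_rank _ _ _ _ f); rewrite det_arc_mx_neq0 // fJ inE cJ eqxx /=.
rewrite (disjointWl JS SL); apply/dinjectiveP => x y xJ yJ.
by apply: arc_index_inj; apply: (subsetP JS).
Qed.

Lemma arc_matroid_positroid L S m : [disjoint S & L] -> (m <= #|S|)%N ->
  arc_matroid L S m \in positroids R n m.
Proof.
move=> SL mS; rewrite inE; apply/asboolP; exists (arc_mx L S m).
  exact: arc_mx_tnn.
by rewrite arc_mx_row_matroid.
Qed.

(** Discard from [S] the starts [s] and [t] of the arcs of the two given elements; any [m - 2] of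
    the remaining starts complete the pair, as distinct starts lie on distinct arcs. *)
Lemma arc_matroid_extend L S m I : [disjoint S & L] -> (2 <= m <= #|S|)%N ->
    I \in arc_matroid L S 2 ->
  exists2 J, J \in arc_matroid L S m & I \subset J.
Proof.
move=> SL /andP[m2 mS] IA; have := IA; rewrite inE => /andP[/eqP cI _].
have [i [j [ij EI]]] := cards2P _ (introT eqP cI); subst I.
have := IA; rewrite arc_matroid_pair => /and3P[iL jL vij].
have [s [sS sL vs]] := setI_start i SL (leq_trans (ltnW m2) mS).
have [t [tS tL vt]] := setI_start j SL (leq_trans (ltnW m2) mS).
pose S' := S :\: [set s; t].
have cS' : (m - 2 <= #|S'|)%N.
  rewrite cardsD; apply: leq_sub mS _.
  apply: leq_trans (subset_leq_card (subsetIr _ _)) _.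
  by rewrite cards2; case: (s != t).
have /card_gt0P[J] : (0 < #|[set J : {set 'I_n} | J \subset S' & #|J| == m - 2]|)%N.
  by rewrite cards_draws bin_gt0.
rewrite inE => /andP[JS' /eqP cJ].
have JS : J \subset S by apply: subset_trans JS' (subsetDl _ _).
have vJ x y : x \in J -> y \in [set i; j] -> arc_index S x != arc_index S y.
  move=> xJ yI; have xS := subsetP JS x xJ.
  have := subsetP JS' x xJ; rewrite !inE negb_or => /andP[/andP[xs xt] _].
  move: yI; rewrite !inE => /orP[]/eqP->.
    by rewrite -vs; apply: contraNneq xs => /arc_index_inj->.
  by rewrite -vt; apply: contraNneq xt => /arc_index_inj->.
exists (J :|: [set i; j]); last exact: subsetUr.
have dJ : J :&: [set i; j] = set0.
  apply/eqP; rewrite setI_eq0; apply/pred0P => x /=; apply/negbTE/negP => /andP[xJ xI].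
  by have := vJ x x xJ xI; rewrite eqxx.
rewrite inE cardsU dJ cards0 subn0 cJ cI subnK // eqxx /= disjoints_setU.
rewrite (disjointWl JS SL) disjoints_setU !disjoints1 iL jL /=.
have := IA; rewrite inE => /and3P[_ _ /dinjectiveP H].
apply/dinjectiveP => x y /setUP[xJ|xI] /setUP[yJ|yI] E.
- by apply: (arc_index_inj _ _ E); apply: (subsetP JS).
- by have := vJ x y xJ yI; rewrite E eqxx.
- by have := vJ y x yJ xI; rewrite E eqxx.
- exact: H.
Qed.

Lemma arc_matroid_down2 L S k : [disjoint S & L] -> (0 < k)%N ->
    (2 <= n - k <= #|S|)%N ->
  exists2 M, M \in positroids R n k & down2 M = arc_matroid L S 2.
Proof.
move=> SL k0 /andP[nk2 nkS].
have nE : n = (n - k + k)%N by lia.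
have [A tA EA] : exists2 A : 'M[R]_(k, n), tnn_point A &
    row_matroid A = dual (arc_matroid L S (n - k)).
  rewrite -arc_mx_row_matroid; apply: tnn_dual_cast => //; exact: arc_mx_tnn.
exists (row_matroid A); first by rewrite inE; apply/asboolP; exists A.
have dd : dual (row_matroid A) = arc_matroid L S (n - k).
  rewrite EA /dual -imset_comp -[RHS]imset_id; apply: eq_imset => J /=.
  by rewrite setCK.
apply/setP => I; rewrite !inE dd; apply/idP/idP.
  case/andP=> cI /exists_inP[J]; rewrite inE => /and3P[_ JL /dinjectiveP vJ] IJ.
  rewrite cI (disjointWl IJ JL); apply/dinjectiveP => x y xI yI.
  by apply: vJ; apply: (subsetP IJ).
move=> H; have IA : I \in arc_matroid L S 2 by rewrite inE.
case/andP: H => -> _ /=; apply/exists_inP.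
by have [J JA IJ] := arc_matroid_extend SL (introT andP (conj nk2 nkS)) IA; exists J.
Qed.

End ArcMatroid.

(** * Rank 2 envelopes *)

Section PairMatroids.
Variable n : nat.
Implicit Types (T N M : {set {set 'I_n}}) (i j a b c x y s : 'I_n).

(** Basis exchange in rank 2: [cover T] is the set of nonloops, and no nonloop is parallel to both
    elements of an independent pair. *)
Definition pair_exchange T : Prop :=
  (forall I, I \in T -> #|I| = 2%N) /\
  (forall a b c, [set a; b] \in T -> c \in cover T ->
     [set a; c] \in T \/ [set b; c] \in T).

Lemma mem_cover T I x : I \in T -> x \in I -> x \in cover T.
Proof. by move=> IT xI; apply/bigcupP; exists I. Qed.

Lemma pair_neq T a b : pair_exchange T -> [set a; b] \in T -> a != b.
Proof. by move=> [cT _] /cT; rewrite cards2; case: (a != b). Qed.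

(** Take bases [J] avoiding [a] and [b], and [J'] avoiding [c]. If [c] is in [J], exchange it for
    some [x] of [J']; the new basis avoids [c] and, since only [x] was added, at least one of [a]
    and [b]. *)
Lemma down2_pair_exchange (R : realType) k M :
  M \in positroids R n k -> pair_exchange (down2 M).
Proof.
rewrite inE => /asboolP[A _ EM].
have memD a b J : J \in M -> a \notin J -> b \notin J -> a != b ->
    [set a; b] \in down2 M.
  move=> JM aJ bJ ab; rewrite inE cards2 ab /=; apply/exists_inP.
  by exists (~: J); [apply: imset_f|rewrite subUset !sub1set !inE aJ bJ].
split=> [I|a b c]; first by rewrite inE => /andP[/eqP].
have down2P I : I \in down2 M -> exists2 J, J \in M & {in I, forall x, x \notin J}.
  rewrite inE => /andP[_ /exists_inP[_ /imsetP[J JM ->] IJ]]; exists J => // x.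
  by move/(subsetP IJ); rewrite inE.
move=> abT /bigcupP[I /down2P[J' J'M HI] /HI cJ'].
have [J JM HJ] := down2P _ abT.
have ab : a != b.
  by move: abT; rewrite inE cards2 => /andP[]; case: (a != b).
have aJ : a \notin J by apply: HJ; rewrite !inE eqxx.
have bJ : b \notin J by apply: HJ; rewrite !inE eqxx orbT.
have [->|ca] := eqVneq c a; first by right; rewrite setUC.
have [->|cb] := eqVneq c b; first by left.
have [cJ|cJ] := boolP (c \in J); last first.
  by left; apply: (memD _ _ J); rewrite // eq_sym.
move: (JM) (J'M); rewrite EM => JA J'A.
have [x /andP[xJ' xJ]] := row_matroid_exchange JA J'A cJ cJ'.
rewrite -EM => KM; have cK : c \notin x |: J :\ c.
  by rewrite !inE eqxx orbF; apply: contraNneq cJ' => ->.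
have [xa|xa] := eqVneq x a; [right|left];
  apply: (memD _ _ _ KM _ cK); rewrite 1?eq_sym //.
  by rewrite !inE (negPf bJ) andbF orbF xa eq_sym.
by rewrite !inE (negPf aJ) andbF orbF eq_sym.
Qed.

Section Rank2.
Variables (R : realType) (N : {set {set 'I_n}}).
Hypothesis NP : N \in positroids R n 2.

(** In a basis consisting of [c] and some [d], exchange [d] for an element of [[set a; b]]. *)
Lemma rank2_exchange a b c : [set a; b] \in N -> c \in cover N ->
  [set a; c] \in N \/ [set b; c] \in N.
Proof.
move=> abN /bigcupP[I IN cI]; move: NP; rewrite inE => /asboolP[A _ EN].
have [d [dc EI]] : exists d, d != c /\ I = [set d; c].
  have : #|I| == 2%N by move: IN; rewrite EN => /row_matroid_card/eqP.
  move=> /cards2P[u [v [uv EI]]]; move: cI; rewrite EI !inE => /orP[]/eqP->.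
    by exists v; rewrite eq_sym uv setUC.
  by exists u.
have [->|ca] := eqVneq c a; first by right; rewrite setUC.
have [->|cb] := eqVneq c b; first by left.
have [dab|dab] := boolP (d \in [set a; b]).
  by move: dab; rewrite !inE => /orP[]/eqP <-; rewrite -EI; [left|right].
move: abN IN; rewrite EN => abA IA.
have dI : d \in I by rewrite EI !inE eqxx.
have [x /andP[xab _]] := row_matroid_exchange IA abA dI dab.
have -> : I :\ d = [set c].
  apply/setP => u; rewrite EI !inE; have [->|] := eqVneq u d => //.
  by rewrite (negPf dc).
by move: xab; rewrite !inE => /orP[]/eqP->; [left|right].
Qed.

(* The three-term Pluecker relation is a sum of two nonnegative terms. *)
Lemma rank2_crossing i x j y : (i < x < j)%N -> (y < i)%N || (j < y)%N ->
  [set i; x] \in N -> [set j; y] \in N -> [set i; j] \in N.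
Proof.
move=> /andP[ix xj] Hy; move: NP; rewrite inE => /asboolP[A [_ pA] ->].
pose p u v := A 0 u * A 1 v - A 0 v * A 1 u.
pose f u v : {ffun 'I_2 -> 'I_n} := [ffun r => if r == 0 then u else v].
have detf u v : \det (colsub (f u v) A) = p u v.
  rewrite (expand_det_row _ 0) !big_ord_recl big_ord0 addr0 /cofactor !det_mx11.
  rewrite !mxE !ffunE /= expr0 expr1 mul1r mulN1r mulrN.
  by congr (A 0 _ * A _ _ - A _ _ * A _ _); apply/val_inj.
have fI (u v : 'I_n) : (u < v)%N -> increasing (f u v).
  move=> uv; apply/increasingP => r t; rewrite !ffunE.
  by case: (r =P 0) => [->|/eqP r0]; case: (t =P 0) => [->|/eqP t0] //;
    move: r t r0 t0 => [[|[|//]] ?] [[|[|//]] ?].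
have fE u v : f u v @: [set: 'I_2] = [set u; v].
  apply/setP => w; rewrite !inE; apply/imsetP/orP => [[r _ ->]|].
    by rewrite ffunE; case: ifP; [left|right].
  case=> /eqP->; first by exists 0; rewrite ?ffunE.
  by exists 1; rewrite ?ffunE.
have p0 (u v : 'I_n) : (u < v)%N -> 0 <= p u v.
  by move=> uv; rewrite -detf; apply/pA/fI.
have pE (u v : 'I_n) : (u < v)%N -> ([set u; v] \in row_matroid A) = (p u v != 0).
  by move=> uv; rewrite -fE mem_row_matroid ?detf //; apply: fI.
have ij := ltn_trans ix xj; rewrite (pE _ _ ix) (pE _ _ ij) => pix.
case/orP: Hy => Hy; [rewrite setUC (pE _ _ (ltn_trans Hy ij))|rewrite (pE _ _ Hy)];
  move=> pjy; apply/eqP => pij.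
(* Here [y < i < x < j]. If [p i j] were 0, both nonnegative summands would vanish, but
   [p y j * p i x] does not. The other case is the same with [i < x < j < y]. *)
- have E : p y x * p i j = p y i * p x j + p y j * p i x by rewrite /p; ring.
  have := mulf_neq0 pjy pix; rewrite pij mulr0 in E.
  have : 0 <= p y i * p x j by rewrite mulr_ge0 ?p0.
  have : 0 <= p y j * p i x by rewrite mulr_ge0 ?p0 // (ltn_trans Hy).
  move=> h1 h2; move/esym/eqP: E; rewrite paddr_eq0 // => /andP[_ /eqP->].
  by rewrite eqxx.
- have E : p i j * p x y = p i x * p j y + p i y * p x j by rewrite /p; ring.
  have := mulf_neq0 pix pjy; rewrite pij mul0r in E.
  have : 0 <= p i x * p j y by rewrite mulr_ge0 ?p0.
  have : 0 <= p i y * p x j by rewrite mulr_ge0 ?p0 // (ltn_trans ij).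
  move=> h1 h2; move/esym/eqP: E; rewrite paddr_eq0 // => /andP[/eqP-> _].
  by rewrite eqxx.
Qed.

End Rank2.

(* The elements s independent from the preceding nonloop a. *)
Definition starts T : {set 'I_n} :=
  [set s | [exists a, ([set a; s] \in T) &&
     [forall x, (x \in oc_interval a s) && (x != s) ==> (x \notin cover T)]]].

Lemma startsP T s :
  reflect (exists2 a, [set a; s] \in T &
             forall x, x \in oc_interval a s -> x != s -> x \notin cover T)
    (s \in starts T).
Proof.
rewrite inE; apply: (iffP existsP) => [[a /andP[aT /forallP H]]|[a aT H]].
  by exists a => // x xI xs; have := H x; rewrite xI xs.
exists a; rewrite aT; apply/forallP => x; apply/implyP => /andP[]; exact: H.
Qed.

Definition cyc_dist i x : nat := if (i <= x)%N then (x - i)%N else (n + x - i)%N.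

Lemma oc_intervalE i j x :
  (x \in oc_interval i j) = (0 < cyc_dist i x <= cyc_dist i j)%N.
Proof.
have := ltn_ord x; have := ltn_ord i; have := ltn_ord j.
rewrite inE /cyc_dist; case: (leqP i j); case: (leqP i x); lia.
Qed.

(** When [a] comes before [y] on the way round from [i], the interval from [a] to [y] does not pass
    [i], so distances from [i] increase along it. *)
Lemma oc_interval_dist i a y x : (cyc_dist i a < cyc_dist i y)%N ->
    x \in oc_interval a y -> x != y ->
  (cyc_dist i a < cyc_dist i x < cyc_dist i y)%N.
Proof.
have := ltn_ord a; have := ltn_ord i; have := ltn_ord x; have := ltn_ord y.
rewrite -(inj_eq val_inj) inE /cyc_dist /=.
move: (nat_of_ord i) (nat_of_ord a) (nat_of_ord y) (nat_of_ord x); clear.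
move=> i a y x yn xn i_n an.
by case: (leqP i a); case: (leqP i x); case: (leqP i y); case: (leqP a y) => /=; lia.
Qed.

Lemma cyc_dist_gt0 i x : (0 < cyc_dist i x)%N = (x != i).
Proof.
have := ltn_ord x; have := ltn_ord i; rewrite -(inj_eq val_inj) /cyc_dist /=.
by case: (leqP i x); lia.
Qed.

(** Let [y] be the first element after [i] independent from [i], and [a] the last nonloop before
    [y]. Then [a] is [i] or, by minimality of [y], not independent from [i]; so the exchange
    property makes [a] and [y] independent, and [y] is a start. *)
Lemma starts_meet T i j : pair_exchange T -> [set i; j] \in T ->
  exists2 s, s \in starts T & s \in oc_interval i j.
Proof.
move=> TP ijT; have [_ ex] := TP; have ij := pair_neq TP ijT.
have iT : i \in cover T by apply: (mem_cover ijT); rewrite !inE eqxx.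
have Pj : (j \in oc_interval i j) && ([set i; j] \in T).
  rewrite ijT andbT inE leqnn andbT.
  by case: ltngtP ij => // /val_inj->; rewrite eqxx.
case: (@arg_minnP _ j (fun y => (y \in oc_interval i j) && ([set i; y] \in T))
  (cyc_dist i) Pj) => y /andP[yI iyT] ymin.
have Pi : (cyc_dist i i < cyc_dist i y)%N && (i \in cover T).
  by move: yI; rewrite iT andbT oc_intervalE /cyc_dist leqnn subnn => /andP[].
case: (@arg_maxnP _ i
  (fun a => (cyc_dist i a < cyc_dist i y)%N && (a \in cover T)) (cyc_dist i) Pi) => a /andP[ay aT] amax.
exists y => //; apply/startsP; exists a.
  have [->//|ai] := eqVneq a i.
  have [iaT|] := ex i y a iyT aT; last by rewrite setUC.
  have aI : a \in oc_interval i j.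
    move: yI; rewrite !oc_intervalE => /andP[_ yj].
    by rewrite cyc_dist_gt0 ai /= (leq_trans (ltnW ay)).
  by have := ymin a; rewrite aI iaT leqNgt ay => /(_ isT).
move=> x xI xy; apply/negP => xT.
have /andP[h1 h2] := oc_interval_dist ay xI xy.
by have := amax x; rewrite /= h2 xT leqNgt h1 => /(_ isT).
Qed.

Lemma starts_cover T : starts T \subset cover T.
Proof.
apply/subsetP => s /startsP[a aT _]; apply: (mem_cover aT).
by rewrite !inE eqxx orbT.
Qed.

Lemma starts_arc_index T i j : pair_exchange T -> [set i; j] \in T ->
  arc_index (starts T) i != arc_index (starts T) j.
Proof.
move=> TP ijT; apply/arc_index_neqP; split; first exact: starts_meet.
by apply: starts_meet; rewrite // setUC.
Qed.

Lemma pair_exchange_sub_arc_matroid T : pair_exchange T ->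
  T \subset arc_matroid (~: cover T) (starts T) 2.
Proof.
move=> TP; apply/subsetP => I IT; have [cT _] := TP.
have /cards2P[i [j [_ EI]]] : #|I| == 2%N by apply/eqP/cT.
subst I; rewrite arc_matroid_pair !inE !negbK starts_arc_index // andbT.
by apply/andP; split; apply: (mem_cover IT); rewrite !inE eqxx ?orbT.
Qed.

(** A start between [i] and [j] gives a pair of [N] inside the interval from [i] to [j], and by
    exchange [i] is independent in [N] from some [x] there. Likewise [j] is independent from some
    [y] on the other side. Unless [x] is [j] or [y] is [i], the Pluecker relation for [i], [x], [j],
    [y] makes [i] and [j] independent. *)
Lemma arc_matroid_sub_positroid (R : realType) T N : N \in positroids R n 2 ->
  T \subset N -> arc_matroid (~: cover T) (starts T) 2 \subset N.
Proof.
move=> NP TN; have cTN x : x \in cover T -> x \in cover N.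
  by case/bigcupP=> I /(subsetP TN) IN xI; apply: mem_cover IN xI.
have pN a b : [set a; b] \in N -> a != b.
  move: NP; rewrite inE => /asboolP[A _ ->] /row_matroid_card.
  by rewrite cards2; case: (a != b).
suff H i j : (i < j)%N -> i \in cover T -> j \in cover T ->
    arc_index (starts T) i != arc_index (starts T) j -> [set i; j] \in N.
  apply/subsetP => I IA; have /cards2P[i [j [ij EI]]] : #|I| == 2%N.
    by move: IA; rewrite inE => /andP[].
  subst I; move: IA; rewrite arc_matroid_pair !inE !negbK => /and3P[iT jT vij].
  case: (ltngtP i j) => [/H|/H|/val_inj E]; first exact.
    by rewrite setUC; apply; rewrite 1?eq_sym.
  by rewrite E eqxx in ij.
move=> ij iT jT /arc_index_neqP[[s /startsP[a asT Ha] sI] [t /startsP[b btT Hb] tI]].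
have sij : (i < s <= j)%N by move: sI; rewrite inE ltnW.
have tij : (j < t)%N || (t <= i)%N by move: tI; rewrite inE leqNgt ij.
have as_ := pN _ _ (subsetP TN _ asT); have bt := pN _ _ (subsetP TN _ btT).
rewrite -(inj_eq val_inj) /= in as_; rewrite -(inj_eq val_inj) /= in bt.
(* There is no nonloop strictly between [a] and [s], so the nonloop [i] is not passed on the way
   from [a] to [s]. *)
have ai : (i <= a < s)%N.
  have : ~~ ((i \in oc_interval a s) && (i != s)).
    by apply: (contraL _ iT) => /andP[]; apply: Ha.
  rewrite inE -(inj_eq val_inj) /=.
  by move: ij sij as_; clear; case: (leqP a s) => /=; lia.
have bi : (j <= b)%N || (b <= i)%N.
  have : ~~ ((j \in oc_interval b t) && (j != t)).
    by apply: (contraL _ jT) => /andP[]; apply: Hb.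
  rewrite inE -(inj_eq val_inj) /=.
  by move: ij tij bt; clear; case: (leqP b t) => /=; lia.
have asN := subsetP TN _ asT; have btN := subsetP TN _ btT.
have [x [xi ixN]] : exists x, (i <= x <= j)%N /\ [set i; x] \in N.
  have [H|H] := rank2_exchange NP asN (cTN _ iT); [exists a|exists s];
    rewrite setUC; split=> //; move: ij sij ai; clear; lia.
have [y [yi jyN]] : exists y, ((j <= y)%N || (y <= i)%N) /\ [set j; y] \in N.
  have [H|H] := rank2_exchange NP btN (cTN _ jT); [exists b|exists t];
    rewrite setUC; split=> //; move: tij bi; clear; lia.
have [E|xj] := eqVneq x j; first by rewrite -E.
have [E|yi'] := eqVneq y i; first by rewrite setUC -E.
have := pN _ _ ixN; have := pN _ _ jyN.
move: xj yi'; rewrite -!(inj_eq val_inj) /= => xj yi' jy ix.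
apply: (rank2_crossing NP _ _ ixN jyN).
  by move: xi xj ix; clear; lia.
by move: ij yi yi' jy; clear; lia.
Qed.

(** An independent pair yields a start in each of the two disjoint intervals between its
    elements. *)
Lemma starts_card T : pair_exchange T -> T != set0 -> (2 <= #|starts T|)%N.
Proof.
move=> TP /set0Pn[I IT]; have [cT _] := TP.
have /cards2P[i [j [ij EI]]] : #|I| == 2%N by apply/eqP/cT.
subst I; have [s sS sI] := starts_meet TP IT.
have [t tS tI] : exists2 t, t \in starts T & t \in oc_interval j i.
  by apply: starts_meet; rewrite // setUC.
have st : s != t.
  apply: contraTneq sI => ->; move: tI ij; rewrite -!(inj_eq val_inj) !inE.
  by case: (ltngtP i j) => //; lia.
have : (#|[set s; t]| <= #|starts T|)%N.
  by apply/subset_leq_card; rewrite subUset !sub1set sS tS.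
by rewrite cards2 st.
Qed.

Lemma starts_disjoint T : [disjoint starts T & ~: cover T].
Proof. by rewrite disjoints_subset setCK starts_cover. Qed.

(** The arc matroid is a positroid containing [T] and lies in every rank 2 positroid containing [T].
    A smallest one is unique, so it is the one picked. *)
Lemma env_arc_matroid (R : realType) T : pair_exchange T -> T != set0 ->
  env R 2 T = arc_matroid (~: cover T) (starts T) 2.
Proof.
move=> TP T0; set N := arc_matroid _ _ _.
have NP : N \in positroids R n 2.
  by apply: arc_matroid_positroid; [apply: starts_disjoint|apply: starts_card].
have TN : T \subset N by apply: pair_exchange_sub_arc_matroid.
have NE : is_env R 2 T N.
  rewrite /is_env NP TN; apply/forall_inP => N' N'P; apply/implyP.
  exact: arc_matroid_sub_positroid N'P.
rewrite /env; case: pickP => [N' /and3P[N'P TN' /forall_inP H]|/(_ N)]; last first.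
  by rewrite NE.
apply/eqP; rewrite eqEsubset (implyP (H N NP)) //=.
exact: arc_matroid_sub_positroid N'P TN'.
Qed.

End PairMatroids.

(** * The intervals of a rank 2 positroid *)

Section Statistics.
Variables (n : nat) (L S : {set 'I_n}).
Hypotheses (SL : [disjoint S & L]) (S2 : (2 <= #|S|)%N).
Let N := arc_matroid L S 2.
Let S0 : (0 < #|S|)%N := ltnW S2.

Let sL s : s \in S -> s \notin L.
Proof. by move=> sS; rewrite (disjointFr SL sS). Qed.

Let mem_pair i j : i \notin L -> j \notin L -> arc_index S i != arc_index S j ->
  [set i; j] \in N.
Proof. by move=> iL jL vij; rewrite arc_matroid_pair iL jL. Qed.

Lemma ex_other_start i : exists2 s, s \in S & arc_index S s != arc_index S i.
Proof.
have /card_gt1P[s [t [sS tS st]]] := S2.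
have [E|] := eqVneq (arc_index S s) (arc_index S i); last by exists s.
exists t => //; rewrite -E; apply: contraNneq st => H; apply/eqP.
by apply: (arc_index_inj sS tS).
Qed.

Lemma cover_arc_matroid : cover N = ~: L.
Proof.
apply/setP => i; rewrite inE; apply/bigcupP/idP => [[I]|iL].
  rewrite inE => /and3P[_ IL _] iI; by rewrite (disjointFr IL iI).
have [s sS vs] := ex_other_start i.
exists [set i; s]; last by rewrite !inE eqxx.
by apply: mem_pair => //; [apply: sL|rewrite eq_sym].
Qed.

(** If [s] is a start with preceding nonloop [a], some element of [S] lies after [a] and up to [s];
    the elements strictly between are loops, so it is [s]. Conversely, for [s] in [S] and [a] the
    last nonloop before it, [s] and another element [t] of [S] separate [a] from [s] on both
    sides. *)
Lemma starts_arc_matroid : starts N = S.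
Proof.
apply/setP => s; apply/startsP/idP => [[a asN H]|sS].
  have /and3P[aL sL' /arc_index_neqP[[u uS uI] _]] :
    [&& a \notin L, s \notin L & arc_index S a != arc_index S s].
    by rewrite -arc_matroid_pair.
  have [<-//|us] := eqVneq u s.
  by have := H u uI us; rewrite cover_arc_matroid inE sL.
have [t tS vt] := ex_other_start s.
have ts : t != s by apply: contraNneq vt => ->.
have Pt : (t \notin L) && (t != s) by rewrite sL.
case: (@arg_minnP _ t (fun a => (a \notin L) && (a != s)) (fun a => cyc_dist a s) Pt).
move=> a /andP[aL as_] amin.
have as' : val a != val s by rewrite (inj_eq val_inj).
have between x : x \in oc_interval a s -> x != s -> x \in L.
  move=> xI xs; apply: contraT => xL; have := amin x; rewrite xL xs => /(_ isT).
  have xs' : val x != val s by rewrite (inj_eq val_inj).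
  move: xI xs' as'; rewrite inE /cyc_dist; clear -n.
  have := ltn_ord a; have := ltn_ord s; have := ltn_ord x.
  by case: (leqP a s); case: (leqP x s) => /=; lia.
exists a.
  apply: mem_pair => //; first exact: sL.
  apply/arc_index_neqP; split.
    by exists s => //; rewrite inE leqnn; case: ltngtP as'.
  exists t => //; have [//|tI] := boolP (t \in oc_interval s a).
  have : t \in L.
    apply: between => //; move: tI as' (ts); rewrite -(inj_eq val_inj) !inE /=.
    by clear; case: (leqP a s); case: (leqP s a) => /=; lia.
  by rewrite (negPf (sL tS)).
by move=> x xI xs; rewrite cover_arc_matroid inE negbK between.
Qed.

Lemma loops_arc_matroid : loops N = L.
Proof.
apply/setP => i; rewrite inE /mrank; apply/eqP/idP => [H|iL].
  apply: contraT; rewrite -in_setC -cover_arc_matroid => /bigcupP[I IN iI].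
  have := leq_bigmax_cond (F := fun B : {set 'I_n} => #|B :&: [set i]|) I IN.
  by rewrite H leqn0 cards_eq0 setI_eq0 disjoint_sym disjoints1 iI.
apply/eqP; rewrite -leqn0; apply/bigmax_leqP => I.
rewrite inE => /and3P[_ IL _].
by rewrite leqn0 cards_eq0 setI_eq0 disjoint_sym disjoints1 (disjointFl IL iL).
Qed.

Lemma mrank1P (I : {set 'I_n}) : reflect
  ((exists2 x, x \in I & x \notin L) /\
   {in I &, forall x y, x \notin L -> y \notin L -> arc_index S x = arc_index S y})
  (mrank N I == 1%N).
Proof.
have card_meet B : B \in N -> (#|B :&: I| <= mrank N I)%N.
  move=> BN.
  exact: (leq_bigmax_cond (F := fun B : {set 'I_n} => #|B :&: I|) B BN).
apply: (iffP eqP) => [r1|[[x xI xL] vI]].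
  split.
    have : (0 < mrank N I)%N by rewrite r1.
    rewrite lt0n => H; apply/exists_inP; apply: contraR H => /exists_inPn H.
    rewrite -leqn0; apply/bigmax_leqP => B; rewrite inE => /and3P[_ BL _].
    rewrite leqn0 cards_eq0 setI_eq0; apply/pred0P => x /=; apply/negbTE/negP.
    by move=> /andP[xB /H]; rewrite negbK (disjointFr BL xB).
  move=> x y xI yI xL yL; apply/eqP; apply: contraT => vxy.
  have := card_meet _ (mem_pair xL yL vxy); rewrite r1.
  have -> : [set x; y] :&: I = [set x; y].
    by apply/setIidPl; rewrite subUset !sub1set xI yI.
  by rewrite cards2; have -> : x != y by apply: contraNneq vxy => ->.
apply/eqP; rewrite eqn_leq; apply/andP; split; last first.
  have : x \in cover N by rewrite cover_arc_matroid inE.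
  case/bigcupP => B BN xB; apply: leq_trans (card_meet B BN).
  by rewrite card_gt0; apply/set0Pn; exists x; rewrite inE xB.
apply/bigmax_leqP => B; rewrite inE => /and3P[_ BL /dinjectiveP vB].
apply/card_le1_eqP => u w /setIP[uB uI] /setIP[wB wI]; apply: vB => //.
by apply: vI; rewrite ?(disjointFr BL uB) ?(disjointFr BL wB).
Qed.

(** Each member of [F] meets [S] in exactly one element, the start of its arc, so [#|F|] is the
    number of elements of [S] covered. Every nonloop outside [S] is covered too, being parallel to
    the start of its arc. *)
Lemma presents_card (F : {set {set 'I_n}}) : presents N F ->
  #|cover F :\: L| = (#|F| + #|~: L :\: S|)%N.
Proof.
case/and4P => _ tF /forall_inP F1; rewrite loops_arc_matroid => /eqP NE.
have pairF x y : x \notin L -> y \notin L -> x != y ->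
    arc_index S x = arc_index S y -> exists2 I, I \in F & [set x; y] \subset I.
  move=> xL yL xy vxy; apply/exists_inP.
  have : [set x; y] \notin N by rewrite arc_matroid_pair vxy eqxx !andbF.
  rewrite {1}NE inE cards2 xy disjoints_setU !disjoints1 xL yL /=.
  by apply: contraR => /exists_inPn H; apply/forall_inP.
have start_in (I : {set 'I_n}) : I \in F -> #|I :&: S| = 1%N.
  move=> IF; have /mrank1P[[x xI xL] vI] := F1 I IF.
  have [s [sS sL' vs]] := setI_start x SL S0.
  have sI : s \in I.
    have [->//|sx] := eqVneq s x.
    have [I' I'F] := pairF s x sL' xL sx vs.
    rewrite subUset !sub1set => /andP[sI' xI'].
    suff -> : I = I' by [].
    apply/eqP; apply: contraT => /(trivIsetP tF _ _ IF I'F) dI.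
    by have := disjointFr dI xI; rewrite xI'.
  apply/eqP/cards1P; exists s; apply/setP => u; rewrite !inE.
  apply/andP/eqP => [[uI uS]|->//].
  by apply: (arc_index_inj uS sS); apply: vI => //; apply: sL.
have -> : #|F| = #|cover F :&: S|.
  rewrite -!sum1_card [RHS](eq_bigl (fun x => (x \in cover F) && (x \in S))).
    rewrite big_trivIset_cond //=; apply: eq_bigr => I IF.
    by rewrite -{1}(start_in I IF) -sum1_card; apply: eq_bigl => x; rewrite inE.
  by move=> x; rewrite inE.
rewrite -cardsUI; have -> : (cover F :&: S) :&: (~: L :\: S) = set0.
  by apply/setP => x; rewrite !inE; case: (x \in S); rewrite ?andbF.
rewrite cards0 addn0; congr #|pred_of_set _|; apply/setP => x; rewrite !inE.
have [xS|xS] /= := boolP (x \in S); first by rewrite sL // andbT orbF.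
rewrite andbF /=; have [//|xL] /= := boolP (x \in L).
have [s [sS sL' vs]] := setI_start x SL S0.
have sx : s != x by apply: contraNneq xS => <-.
have [I IF] := pairF s x sL' xL sx vs.
by rewrite subUset !sub1set => /andP[_ xI]; apply: (mem_cover IF).
Qed.

Definition arcs : {set {set 'I_n}} := preim_partition (arc_index S) setT.

Lemma arcsP (I : {set 'I_n}) :
  reflect (exists x, I = [set y | arc_index S y == arc_index S x]) (I \in arcs).
Proof.
apply: (iffP imsetP) => [[x _ ->]|[x ->]]; exists x => //; apply/setP => y;
  by rewrite !inE eq_sym.
Qed.

(** Provides a first presentation, from which a minimal one is found. *)
Lemma presents_arcs : presents N arcs.
Proof.
have /and3P[_ tF _] := preim_partitionP (arc_index S) [set: 'I_n].
apply/and4P; split=> //.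
- apply/forall_inP => _ /arcsP[x ->].
  have [a [b ->]] := arc_cyc_interval x S0.
  by apply/existsP; exists a; apply/existsP; exists b.
- apply/forall_inP => _ /arcsP[x ->]; apply/mrank1P; split.
    have [s [sS sL' vs]] := setI_start x SL S0; exists s => //.
    by rewrite inE vs.
  by move=> y z; rewrite !inE => /eqP-> /eqP->.
rewrite loops_arc_matroid; apply/eqP/setP => B; rewrite !inE.
apply/and3P/and3P => -[cB BL H]; split=> //.
  apply/forall_inP => _ /arcsP[x ->]; apply/negP => BI.
  have /cards2P[i [j [ij EB]]] := cB; move/dinjectiveP: H => vB.
  move: BI vB; rewrite EB subUset !sub1set !inE => /andP[/eqP vi /eqP vj] vB.
  by move: ij; rewrite (vB i j) ?eqxx // ?inE ?eqxx ?orbT // vi vj.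
have /cards2P[i [j [ij EB]]] := cB; apply/dinjectiveP.
have vij : arc_index S i != arc_index S j.
  apply/eqP => vij; move/forall_inP: H => H.
  have /H : [set y | arc_index S y == arc_index S i] \in arcs.
    by apply/arcsP; exists i.
  by rewrite EB subUset !sub1set !inE vij eqxx.
move=> x y; rewrite EB !inE => /orP[]/eqP-> /orP[]/eqP-> // E;
  by rewrite E eqxx in vij.
Qed.

Lemma ex_min_presents : exists F, min_presents N F.
Proof.
(* Since [#|cover F|] is at most [n], the weight [w] orders presentations lexicographically, first
   by number of intervals and then by total size. *)
pose w (F : {set {set 'I_n}}) := (#|F| * n.+1 + #|cover F|)%N.
case: (@arg_minnP _ arcs (presents N) w presents_arcs) => F FN Fmin; exists F.
have cn (G : {set {set 'I_n}}) : (#|cover G| <= n)%N.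
  by apply: leq_trans (max_card _) _; rewrite card_ord.
apply/and3P; split=> //; apply/forallP => G; apply/implyP.
  move=> GN; rewrite leqNgt; apply/negP => GF.
  have := Fmin G GN; rewrite /w leqNgt => /negP; apply.
  apply: leq_trans (leq_addr _ _); apply: leq_trans (leq_mul GF (leqnn n.+1)).
  by rewrite mulSn addnC ltn_add2r ltnS.
by case/andP=> /Fmin H /eqP E; move: H; rewrite /w E leq_add2l.
Qed.

(** By [presents_card] the statistic is [2 * #|L|] plus the number of nonloops outside [S], and [L]
    is contained in the complement of [S]. *)
Lemma cstat_arc_matroid : cstat N = (#|~: S| + #|L|)%N.
Proof.
rewrite /cstat /intervals loops_arc_matroid; case: pickP => [F FN|H]; last first.
  by have [F] := ex_min_presents; rewrite H.
have /and3P[pF _ _] := FN; rewrite /= presents_card // addnA addnAC addnK.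
rewrite -(cardsID L (~: S)) mul2n -addnn.
have -> : ~: S :&: L = L.
  by apply/setIidPr; rewrite -disjoints_subset disjoint_sym.
have -> : ~: L :\: S = ~: S :\: L by apply/setP => x; rewrite !inE andbC.
by rewrite addnAC.
Qed.

End Statistics.

(** * The generating function *)

Lemma sum_exp_powerset (T : finType) (A : {set T}) :
  \sum_(B : {set T} | B \subset A) 'X^#|B| = (1 + 'X) ^+ #|A| :> {poly int}.
Proof.
rewrite exprDn (partition_big (fun B : {set T} => inord #|B| : 'I_#|A|.+1) predT) //=.
apply: eq_bigr => i _; rewrite expr1n mul1r -cards_draws -sumr_const.
apply: eq_big => [B|B /andP[/subset_leq_card BA /eqP <-]]; last by rewrite inordK.
rewrite inE; have [BA|//] := boolP (B \subset A).
by rewrite -val_eqE /= inordK ?ltnS ?subset_leq_card.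
Qed.

Lemma env_down2E (R : realType) (n k : nat) : (0 < k)%N -> (2 <= n - k)%N ->
  env_down2 R n k = [set arc_matroid q.2 (~: q.1) 2 |
    q in [set q : {set 'I_n} * {set 'I_n} | (q.2 \subset q.1) && (#|q.1| <= k)%N]].
Proof.
move=> k0 nk; apply/setP => N; apply/imsetP/imsetP => [[M MP ->]|[[A L]]].
  have TP := down2_pair_exchange MP.
  have [J JM] : exists J, J \in M.
    by move: MP; rewrite inE => /asboolP[A [rA _] ->]; apply: row_matroid_neq0.
  have cJ : #|J| = k.
    by move: MP JM; rewrite inE => /asboolP[A _ ->]; apply: row_matroid_card.
  have cCJ : #|~: J| = (n - k)%N by rewrite cardsCs setCK card_ord cJ.
  have pairT a b : a \in ~: J -> b \in ~: J -> a != b -> [set a; b] \in down2 M.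
    move=> aJ bJ ab; rewrite inE cards2 ab /=; apply/exists_inP.
    by exists (~: J); [apply: imset_f|rewrite subUset !sub1set aJ bJ].
  have T0 : down2 M != set0.
    have /card_gt1P[a [b [aJ bJ ab]]] : (1 < #|~: J|)%N by rewrite cCJ.
    by apply/set0Pn; exists [set a; b]; apply: pairT.
  rewrite env_arc_matroid //; set S := starts _.
  exists (~: S, ~: cover (down2 M)); last by rewrite /= setCK.
  rewrite inE /= setCS starts_cover /= cardsCs setCK card_ord.
  suff : (n - k <= #|S|)%N by lia.
  have S0 : (0 < #|S|)%N by apply: leq_trans (starts_card TP T0).
  have idx_gt0 x : (0 < arc_index S x)%N by apply: arc_index_gt0.
  have gP x : ((arc_index S x).-1 < #|S|)%N by rewrite prednK ?arc_index_card.
  (* Two elements of [~: J] form a pair of [down2 M] and so lie on different arcs. Arc numbers,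
     shifted to start at 0, thus embed [~: J] into ['I_#|S|]. *)
  pose g x := Ordinal (gP x).
  have gI : {in ~: J &, injective g}.
    move=> a b aJ bJ [] /(congr1 succn); rewrite !prednK // => E.
    apply/eqP; apply: contraT => /(pairT a b aJ bJ)/(starts_arc_index TP).
    by rewrite E eqxx.
  by rewrite -cCJ -(card_in_imset gI) -[leqRHS]card_ord max_card.
rewrite inE /= => /andP[LA Ak] ->.
have SL : [disjoint ~: A & L].
  by rewrite disjoints_subset setCS.
have cS : (n - k <= #|~: A|)%N by rewrite cardsCs setCK card_ord leq_sub2l.
have [M MP ME] :=
  @arc_matroid_down2 _ R L (~: A) k SL k0 (introT andP (conj nk cS)).
exists M => //; rewrite ME; have S2 := leq_trans nk cS.
have T0 : arc_matroid L (~: A) 2 != set0.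
  apply: contraTneq (S2) => E.
  have := subset_leq_card (starts_cover (arc_matroid L (~: A) 2)).
  by rewrite starts_arc_matroid // E /cover big_set0 cards0 leqn0 => /eqP->.
(* An arc matroid is its own envelope: its cover and its starts give back [L] and [S]. *)
rewrite -ME env_arc_matroid; last by rewrite ME.
  by rewrite ME cover_arc_matroid // setCK starts_arc_matroid.
exact: down2_pair_exchange MP.
Qed.

Theorem theorem5p3 (R : realType) (n k : nat)
    (hk : (1 <= k)%N) (hnk : (2 <= n - k)%N) :
  \sum_(N in env_down2 R n k) 'X^(cstat N) =
  \sum_(0 <= c < k.+1) ('C(n, c))%:R * 'X^c * (1 + 'X) ^+ c :> {poly int}.
Proof.
have card2 (A : {set 'I_n}) : (#|A| <= k)%N -> (2 <= #|~: A|)%N.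
  by move=> Ak; rewrite cardsCs setCK card_ord; lia.
have disj (A L : {set 'I_n}) : L \subset A -> [disjoint ~: A & L].
  by move=> LA; rewrite disjoints_subset setCS.
(* The sum passes to the pairs of [A] and [L]. This parametrization is injective because the bases
   determine the starts, hence [A], and the cover, hence [L]. *)
rewrite env_down2E // big_imset /=; last first.
  move=> [A L] [A' L']; rewrite !inE /= => /andP[LA Ak] /andP[LA' Ak'] E.
  have := cover_arc_matroid (disj _ _ LA) (card2 _ Ak).
  have := starts_arc_matroid (disj _ _ LA) (card2 _ Ak).
  rewrite E starts_arc_matroid ?disj ?card2 // cover_arc_matroid ?disj ?card2 //.
  by move=> /setC_inj -> /setC_inj ->.
transitivity (\sum_(A : {set 'I_n} | (#|A| <= k)%N)
    \sum_(L : {set 'I_n} | L \subset A) ('X^#|A| * 'X^#|L| : {poly int})).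
  rewrite pair_big_dep /=; apply: eq_big => [[A L]|[A L]]; first by rewrite inE andbC.
  rewrite inE /= => /andP[LA Ak]; rewrite cstat_arc_matroid ?disj ?card2 //.
  by rewrite setCK exprD.
transitivity (\sum_(A : {set 'I_n} | (#|A| <= k)%N)
    ('X^#|A| * (1 + 'X) ^+ #|A| : {poly int})).
  by apply: eq_bigr => A _; rewrite -sum_exp_powerset mulr_sumr.
rewrite big_mkord.
(* Group the sets [A] by size; [inord] keeps the value because the size is at most [k]. *)
rewrite (partition_big (fun A : {set 'I_n} => inord #|A| : 'I_k.+1) predT) //=.
apply: eq_bigr => c _; rewrite -mulrA mulr_natl -[n in 'C(n, _)]card_ord.
rewrite -card_draws -sumr_const.
apply: eq_big => [A|A /andP[Ak /eqP <-]]; last by rewrite inordK.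
rewrite inE; apply/andP/eqP => [[Ak /eqP <-]|->]; first by rewrite inordK.
by rewrite -ltnS ltn_ord -val_eqE /= inordK.
Qed.
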